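(* Let $(\mathfrak g,J,\omega)$ be a $4n$-dimensional complex symplectic Lie algebra which is the complex symplectic oxidation of a $(4n-4)$-dimensional complex symplectic Lie algebra $(\bar{\mathfrak g},\bar J,\bar\omega)$, with associated tensors $\nu,\tau,f,g,\beta$, space $(V,I)$, and $S$ the symmetric part of $g$. Choose $v_1\in V\setminus\{0\}$, set $v_2:=Iv_1$, $f_j:=f(v_j,\cdot)\in\operatorname{End}(\bar{\mathfrak g})$ and $S_{jk}:=S(v_j,v_k)\in\bar{\mathfrak g}^*$ for $j,k\in\{1,2\}$, and $$f_j^{\bar J}:=\frac{f_j-\bar J\circ f_j\circ\bar J}2,\qquad f_j^{-\bar J}:=\frac{f_j+\bar J\circ f_j\circ\bar J}2 .$$ Then $J$ is Abelian if and only if - $\bar J$ is Abelian; - $f_2^{\bar J}=-\bar Jf_1^{\bar J}$, $f_2^{-\bar J}=\bar Jf_1^{-\bar J}$, $f_1^{\bar J}\in\mathfrak{sp}(\bar{\mathfrak g},\bar J,\bar\omega)$; - $S_{12}=-\dfrac{S_{11}-S_{22}}2\circ\bar J$.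
   Context: A complex symplectic Lie algebra $(\mathfrak g,J,\omega)$ is a real Lie algebra with $J\in\operatorname{End}(\mathfrak g)$, $J^2=-\mathrm{Id}$, vanishing Nijenhuis tensor $N_J(X,Y)=[X,Y]+J[JX,Y]+J[X,JY]-[JX,JY]$, and a closed non-degenerate $2$-form $\omega$ with $\omega(JX,Y)=\omega(X,JY)$. $J$ is Abelian if $[X,Y]=[JX,JY]$ for all $X,Y$. Complex symplectic oxidation: $(\mathfrak g,J,\omega)$ of dimension $4n$ is the complex symplectic oxidation of $(\bar{\mathfrak g},\bar J,\bar\omega)$ of dimension $4n-4$ if $\mathfrak g=V\oplus\bar{\mathfrak g}\oplus V^*$ as vector spaces for a two-dimensional real vector space $V$, the only non-zero Lie brackets (up to anti-symmetry) being $$[(v,0,0),(w,0,0)]=(0,\nu(v,w),\tau(v,w)),\quad[(v,0,0),(0,X,0)]=(0,f(v,X),g(v,X)),\quad[(0,X,0),(0,Y,0)]=(0,[X,Y]_{\bar{\mathfrak g}},\beta(X,Y))$$ for $v,w\in V$, $X,Y\in\bar{\mathfrak g}$, with $\nu\in\Lambda^2V^*\otimes\bar{\mathfrak g}$, $\tau\in\Lambda^2V^*\otimes V^*$, $f\in V^*\otimes\operatorname{End}(\bar{\mathfrak g})$, $g\in V^*\otimes\bar{\mathfrak g}^*\otimes V^*$, $\beta\in\Lambda^2\bar{\mathfrak g}^*\otimes V^*$, and $V$ has an almost complex structure $I$ such that $J=I+\bar J+I^*$ (with $(I^*\alpha)(v)=\alpha(Iv)$) and $$\omega\big((v,X,\alpha),(w,Y,\gamma)\big)=\alpha(w)-\gamma(v)+\bar\omega(X,Y).$$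 Regarding $g$ as an element of $V^*\otimes V^*\otimes\bar{\mathfrak g}^*$ via $g(v,w)(X):=g(v,X)(w)$, write $g=S+A$ with $S$ symmetric and $A$ anti-symmetric in the two $V$-arguments. $\mathfrak{sp}(\bar{\mathfrak g},\bar J,\bar\omega)$ is the set of $h\in\operatorname{End}(\bar{\mathfrak g})$ with $h\bar J=\bar Jh$ and $\bar\omega(hX,Y)+\bar\omega(X,hY)=0$. *)

(* Defs.v *)
From HB Require Import structures.
From mathcomp Require Import all_boot all_order all_algebra.
From mathcomp Require Import reals.

Set Implicit Arguments.
Unset Strict Implicit.
Unset Printing Implicit Defensive.

Import Order.TTheory GRing.Theory Num.Theory.
Local Open Scope ring_scope.

Definition dual (R : realType) (V : vectType R) : vectType R := 'Hom(V, R^o).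

(* Tensors are iterated linear maps: an element of V^* (x) V^* (x) W is a term
   of type 'Hom(V, 'Hom(V, W)). *)
Definition alternating (R : realType) (V W : vectType R)
    (b : 'Hom(V, 'Hom(V, W))) : Prop :=
  forall x : V, b x x = 0.

Section Structures.
Variables (R : realType) (V : vectType R).
Implicit Types (br : 'Hom(V, 'Hom(V, V))) (J h : 'End(V))
  (w : 'Hom(V, dual V)).

Definition jacobi br : Prop :=
  forall x y z : V, br x (br y z) + br y (br z x) + br z (br x y) = 0.

Definition almost_complex J : Prop := (J \o J)%VF = - \1%VF.

Definition nijenhuis br J (x y : V) : V :=
  br x y + J (br (J x) y) + J (br x (J y)) - br (J x) (J y).

(* d w = 0 for the Chevalley-Eilenberg differential, up to a global sign. *)
Definition closed_form br w : Prop :=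
  forall x y z : V, w (br x y) z + w (br y z) x + w (br z x) y = 0.

Definition nondegenerate_form w : Prop :=
  forall x : V, (forall y : V, w x y = 0) -> x = 0.

Definition abelian_cs br J : Prop :=
  forall x y : V, br x y = br (J x) (J y).

Definition in_sp J w h : Prop :=
  (h \o J)%VF = (J \o h)%VF /\ forall x y : V, w (h x) y + w x (h y) = 0.

(* The components of h commuting, resp. anti-commuting, with J. *)
Definition lin_part J h : 'End(V) := 2^-1 *: (h - (J \o h \o J)%VF).
Definition antilin_part J h : 'End(V) := 2^-1 *: (h + (J \o h \o J)%VF).

End Structures.

Record csLie (R : realType) := CSLie {
  csl_space :> vectType R;
  csl_br : 'Hom(csl_space, 'Hom(csl_space, csl_space));
  csl_J : 'End(csl_space);
  csl_omega : 'Hom(csl_space, dual csl_space);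
  csl_br_alt : alternating csl_br;
  csl_br_jacobi : jacobi csl_br;
  csl_J_sqr : almost_complex csl_J;
  csl_J_integrable : forall x y : csl_space, nijenhuis csl_br csl_J x y = 0;
  csl_omega_alt : alternating csl_omega;
  csl_omega_closed : closed_form csl_br csl_omega;
  csl_omega_nondeg : nondegenerate_form csl_omega;
  csl_omega_J : forall x y : csl_space,
    csl_omega (csl_J x) y = csl_omega x (csl_J y)
}.

(* [ox_iso] is the identification of V (+) gbar (+) V^* with g. *)
Record oxidation (R : realType) (g gbar : csLie R) := Oxidation {
  ox_V : vectType R;
  ox_dimV : \dim {:ox_V} = 2%N;
  ox_I : 'End(ox_V);
  ox_I_sqr : almost_complex ox_I;
  ox_iso : 'Hom((ox_V * gbar * dual ox_V)%type, g);
  ox_iso_bij : bijective ox_iso;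
  ox_nu : 'Hom(ox_V, 'Hom(ox_V, gbar));
  ox_nu_alt : alternating ox_nu;
  ox_tau : 'Hom(ox_V, 'Hom(ox_V, dual ox_V));
  ox_tau_alt : alternating ox_tau;
  ox_f : 'Hom(ox_V, 'End(gbar));
  ox_g : 'Hom(ox_V, 'Hom(gbar, dual ox_V));
  ox_beta : 'Hom(gbar, 'Hom(gbar, dual ox_V));
  ox_beta_alt : alternating ox_beta;
  ox_br_VV : forall v w : ox_V,
    csl_br g (ox_iso (v, 0, 0)) (ox_iso (w, 0, 0)) =
      ox_iso (0, ox_nu v w, ox_tau v w);
  ox_br_Vg : forall (v : ox_V) (X : gbar),
    csl_br g (ox_iso (v, 0, 0)) (ox_iso (0, X, 0)) =
      ox_iso (0, ox_f v X, ox_g v X);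
  ox_br_gg : forall X Y : gbar,
    csl_br g (ox_iso (0, X, 0)) (ox_iso (0, Y, 0)) =
      ox_iso (0, csl_br gbar X Y, ox_beta X Y);
  ox_br_dual : forall (x : g) (a : dual ox_V),
    csl_br g x (ox_iso (0, 0, a)) = 0;
  ox_J : forall (v : ox_V) (X : gbar) (a : dual ox_V),
    csl_J g (ox_iso (v, X, a)) =
      ox_iso (ox_I v, csl_J gbar X, (a \o ox_I)%VF);
  ox_omega : forall (v w : ox_V) (X Y : gbar) (a c : dual ox_V),
    csl_omega g (ox_iso (v, X, a)) (ox_iso (w, Y, c)) =
      a w - c v + csl_omega gbar X Y
}.

Section SymmetricPart.
Variables (R : realType) (g gbar : csLie R) (O : oxidation g gbar).

(* g(v,w)(X) := g(v,X)(w) *)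
Definition ox_gVV (v w : ox_V O) : dual gbar :=
  linfun (fun X : gbar => ox_g O v X w : R^o).

Definition ox_S (v w : ox_V O) : dual gbar :=
  2^-1 *: (ox_gVV v w + ox_gVV w v).

Definition ox_A (v w : ox_V O) : dual gbar :=
  2^-1 *: (ox_gVV v w - ox_gVV w v).

Lemma ox_gVVE (v w : ox_V O) (X : gbar) : ox_gVV v w X = ox_g O v X w.
Proof.
pose h (Y : gbar) : R^o := ox_g O v Y w.
have lin_h : linear h.
  by move=> a Y Z; rewrite /h linearP /= add_lfunE scale_lfunE.
pose hL := GRing.isLinear.Build R gbar R^o _ h lin_h.
pose H : {linear gbar -> R^o} := HB.pack h hL.
exact: (lfunE H X).
Qed.

Lemma ox_gVV_decomp (v w : ox_V O) : ox_gVV v w = ox_S v w + ox_A v w.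
Proof.
rewrite -scalerDr addrACA subrr addr0 -mulr2n -scaler_nat scalerA mulVf //.
  by rewrite scale1r.
by rewrite pnatr_eq0.
Qed.

Lemma ox_S_sym (v w : ox_V O) : ox_S v w = ox_S w v.
Proof. by rewrite /ox_S addrC. Qed.

Lemma ox_A_anti (v w : ox_V O) : ox_A v w = - ox_A w v.
Proof. by rewrite /ox_A -scalerN opprB. Qed.

End SymmetricPart.

(* Main.v *)
Require Import Defs.
From HB Require Import structures.
From mathcomp Require Import all_boot all_order all_algebra.
From mathcomp Require Import reals.
From mathcomp Require Import lra.

Set Implicit Arguments.
Unset Strict Implicit.
Unset Printing Implicit Defensive.

Import Order.TTheory GRing.Theory Num.Theory.
Local Open Scope ring_scope.

(** Written in the splitting V + gbar + V^*, the invariance of the bracket of g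
    under J separates into conditions on the individual tensors:
    - on nu and tau there is none, because an alternating map on a complex
      line is invariant under I (alternating_plane_inv);
    - the bracket of gbar must be invariant under its own J;
    - f (I v) (J X) = f v X, g (I v) (J X) = g v X and
      beta (J X) (J Y) = beta X Y.
    This is ox_abelianP, and it remains to rewrite the last three equations in
    terms of the vector v1. Since v1 and v2 = I v1 span V, the equations on f
    and g reduce to v = v1 (plane_invP).

    - The equation f2 o J = f1 splits into its parts commuting and
      anti-commuting with J: these are the two relations between f1 and f2
      (comp_J_parts).
    - Closedness of omega on (V, gbar, gbar) expresses beta through f, namely
      - beta(X, Y)(v) = omega (f_v X, Y) + omega (X, f_v Y). The J-invariance of
      beta( . , . )(v) therefore says that only the anti-linear part of f_v
      contributes, i.e. that the linear part of f_v is in sp (ox_beta_invP).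
      For v = v2 this follows from the case v = v1, as sp is stable under
      multiplication by J (in_sp_oppJ).
    - Write g_jk = g (v_j, v_k). The equation on g reads g_21 o J = g_11 and
      g_22 o J = g_12. Integrability of J gives
      (g_11 + g_22) o J = g_12 - g_21 (ox_g_integrable), so that these two
      equations are together equivalent to the single one
      g_12 + g_21 = (g_22 - g_11) o J, which is the condition on S
      (ox_g_invP). *)

(** * Linear maps and complex structures *)

Section BilinearMaps.
Variables (R : realType) (U V W : vectType R).

Lemma bilD (b : 'Hom(U, 'Hom(V, W))) (x y : U) (z : V) :
  b (x + y) z = b x z + b y z.
Proof. by rewrite linearD add_lfunE. Qed.

Lemma bilN (b : 'Hom(U, 'Hom(V, W))) (x : U) (z : V) : b (- x) z = - b x z.
Proof. by rewrite linearN opp_lfunE. Qed.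

Lemma bilZ (b : 'Hom(U, 'Hom(V, W))) (k : R) (x : U) (z : V) :
  b (k *: x) z = k *: b x z.
Proof. by rewrite linearZ scale_lfunE. Qed.

End BilinearMaps.

Lemma alternating_anti (R : realType) (V W : vectType R)
    (b : 'Hom(V, 'Hom(V, W))) (x y : V) :
  alternating b -> b x y = - b y x.
Proof.
move=> b_alt; apply/eqP; rewrite -addr_eq0; apply/eqP.
have := b_alt (x + y).
by rewrite bilD !linearD /= !b_alt add0r addr0.
Qed.

Lemma dualB (R : realType) (V : vectType R) (a b : dual V) (x : V) :
  (a - b) x = a x - b x.
Proof. by rewrite add_lfunE; congr (_ + _); apply: opp_lfunE. Qed.

Section LinearParts.
Variables (R : realType) (V : vectType R).
Implicit Types (J h : 'End(V)) (w : 'Hom(V, dual V)) (x y : V).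

Lemma almost_complexK J x : almost_complex J -> J (J x) = - x.
Proof.
by move=> JJ; rewrite -comp_lfunE JJ opp_lfunE id_lfunE.
Qed.

Lemma lin_partE J h x : lin_part J h x = 2^-1 *: (h x - J (h (J x))).
Proof. by rewrite scale_lfunE add_lfunE opp_lfunE !comp_lfunE. Qed.

Lemma antilin_partE J h x : antilin_part J h x = 2^-1 *: (h x + J (h (J x))).
Proof. by rewrite scale_lfunE add_lfunE !comp_lfunE. Qed.

Lemma lin_antilin_decomp J h x : h x = lin_part J h x + antilin_part J h x.
Proof.
rewrite lin_partE antilin_partE -scalerDr addrACA addNr addr0 -mulr2n.
by rewrite -scaler_nat scalerA mulVf ?scale1r // pnatr_eq0.
Qed.

Lemma lin_part_comm J h x :
  almost_complex J -> lin_part J h (J x) = J (lin_part J h x).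
Proof.
move=> JJ; rewrite !lin_partE linearZ /=; congr (_ *: _).
rewrite linearB /= !(almost_complexK _ JJ).
by rewrite !linearN /= !opprK addrC.
Qed.

Lemma antilin_part_anti J h x :
  almost_complex J -> antilin_part J h (J x) = - J (antilin_part J h x).
Proof.
move=> JJ; rewrite !antilin_partE linearZ -scalerN /=; congr (_ *: _).
rewrite linearD /= !(almost_complexK _ JJ).
by rewrite !linearN /= opprD opprK addrC.
Qed.

(** Precomposition with J turns the part of h2 commuting with J into J times
    itself and the anti-commuting part into - J times itself; the two
    equations are the two components of h2 o J = h1. *)
Lemma comp_J_parts J h1 h2 : almost_complex J ->
  (forall x, h2 (J x) = h1 x) <->
  lin_part J h2 = - (J \o lin_part J h1)%VF /\
  antilin_part J h2 = (J \o antilin_part J h1)%VF.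
Proof.
move=> JJ; have JK x := almost_complexK x JJ; split=> [h21|[h2l h2a] x].
  have h12 x : h1 (J x) = - h2 x by rewrite -h21 JK raddfN.
  split; apply/lfunP=> x; rewrite ?opp_lfunE comp_lfunE.
    rewrite !lin_partE linearZ /= h21 h12 -scalerN; congr (_ *: _).
    by rewrite raddfN opprK raddfD /= JK opprD opprK addrC.
  rewrite !antilin_partE linearZ /= h21 h12; congr (_ *: _).
  by rewrite raddfN raddfB /= JK opprK addrC.
rewrite (lin_antilin_decomp J h2) (lin_antilin_decomp J h1) h2l h2a.
rewrite opp_lfunE !comp_lfunE lin_part_comm // antilin_part_anti //.
by rewrite raddfN /= !JK !opprK.
Qed.

(** The bilinear form w (h x) y + w x (h y) measures the failure of h to be
    infinitesimally symplectic; as J is symmetric for w, passing to the linear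
    part of h takes the J-anti-invariant part of this form, which vanishes iff
    the form is J-invariant. *)
Lemma in_sp_lin_part J w h :
    almost_complex J -> (forall x y, w (J x) y = w x (J y)) ->
  in_sp J w (lin_part J h) <->
  forall x y, w (h x) y + w x (h y) = w (h (J x)) (J y) + w (J x) (h (J y)).
Proof.
move=> JJ wJ; have two0 : (2 : R) != 0 by rewrite pnatr_eq0.
have defect x y : w (lin_part J h x) y + w x (lin_part J h y) =
    2^-1 * ((w (h x) y + w x (h y))
            - (w (h (J x)) (J y) + w (J x) (h (J y)))).
  rewrite !lin_partE !linearZ /= scale_lfunE -scalerDr; congr (_ * _).
  (* w (J (h (J x))) y = w (h (J x)) (J y), and similarly on the right *)
  by rewrite !raddfB /= add_lfunE opp_lfunE -!wJ opprD addrACA.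
split=> [[_ skew] x y|inv].
  apply/eqP; rewrite -subr_eq0; apply/eqP.
  have /eqP := skew x y; rewrite defect mulf_eq0 invr_eq0 (negPf two0) /=.
  by move/eqP.
split=> [|x y]; last by rewrite defect inv subrr mulr0.
by apply/lfunP=> x; rewrite !comp_lfunE lin_part_comm.
Qed.

(** sp is a complex vector space. The multiplier is - J because this is the one
    taking the linear part of f1 to that of f2. *)
Lemma in_sp_oppJ J w h :
    almost_complex J -> (forall x y, w (J x) y = w x (J y)) ->
  in_sp J w h -> in_sp J w (- (J \o h)%VF).
Proof.
move=> JJ wJ [hJ skew]; have hJE x : h (J x) = J (h x).
  by rewrite -!comp_lfunE hJ.
split=> [|x y].
  by apply/lfunP=> x; rewrite !(comp_lfunE, opp_lfunE) linearN /= hJE.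
rewrite !opp_lfunE !comp_lfunE bilN linearN /= -opprD wJ -hJE.
by rewrite skew oppr0.
Qed.

End LinearParts.

(** * Tensors on a complex line *)

Section ComplexPlane.
Variables (R : realType) (V : vectType R) (I : 'End(V)).
Hypotheses (dimV : \dim {:V} = 2%N) (II : almost_complex I).

Lemma complex_plane_span (v w : V) : v != 0 ->
  exists a b : R, w = a *: v + b *: I v.
Proof.
move=> v0; have Iv_notin : I v \notin <[v]>%VS.
  apply/negP=> /vlineP [k Ivk]; have := almost_complexK v II.
  rewrite Ivk linearZ /= Ivk scalerA => /eqP; rewrite -addr_eq0.
  rewrite -{2}[v]scale1r -scalerDl scaler_eq0 (negPf v0) orbF => /eqP kk.
  (* I v = k v would force k ^ 2 = -1 *)
  by have := sqr_ge0 k; nra.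
have basisV : basis_of {:V} [:: I v; v].
  by rewrite basisEfree free_cons seq1_free span_seq1 Iv_notin v0 subvf dimV.
have : w \in <<[:: I v; v]>>%VS by rewrite (span_basis basisV) memvf.
rewrite span_cons span_seq1 => /memv_addP [_ /vlineP [b ->]].
by move=> [_ /vlineP [a ->] ->]; exists a, b; rewrite addrC.
Qed.

(** The determinant of I on the real plane V is 1. *)
Lemma alternating_plane_inv (W : vectType R) (b : 'Hom(V, 'Hom(V, W)))
  (v w : V) : alternating b -> b (I v) (I w) = b v w.
Proof.
move=> b_alt; have [->|v0] := eqVneq v 0.
  by rewrite !linear0 !lfunE.
have [k [l ->]] := complex_plane_span w v0.
rewrite !linearD !linearZ /= !b_alt (almost_complexK _ II).
by rewrite linearN /= (alternating_anti (I v) _ b_alt) opprK !scaler0 addrC.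
Qed.

(** Since I and J square to -1, the equation for I v1 is the one for v1 with
    x replaced by J x. *)
Lemma plane_invP (U W : vectType R) (J : 'End(U)) (b : 'Hom(V, 'Hom(U, W)))
    (v1 : V) : almost_complex J -> v1 != 0 ->
  (forall v x, b (I v) (J x) = b v x) <->
  (forall x, b (I v1) (J x) = b v1 x).
Proof.
move=> JJ v1_neq0; split=> [inv x|inv v x]; first exact: inv.
have [k [l ->]] := complex_plane_span v v1_neq0.
rewrite linearD !linearZ /= (almost_complexK _ II) !bilD !bilZ bilN inv.
by rewrite -(inv (J x)) (almost_complexK _ JJ) (linearN (b (I v1))) opprK.
Qed.

End ComplexPlane.

(** * The bracket, closedness and integrability on an oxidation *)

Section Oxidation.
Variables (R : realType) (g gbar : csLie R) (O : oxidation g gbar).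
Local Notation V := (ox_V O).
Local Notation I := (ox_I O).
Local Notation J := (csl_J gbar).
Local Notation br := (csl_br gbar).
Local Notation omega := (csl_omega gbar).
Local Notation f := (ox_f O).
Local Notation gt := (ox_g O).
Local Notation beta := (ox_beta O).
Local Notation iso := (ox_iso O).

Let JJ : almost_complex J := csl_J_sqr gbar.
Let II : almost_complex I := ox_I_sqr O.

Lemma ox_iso_inj v X a w Y c :
  iso (v, X, a) = iso (w, Y, c) -> [/\ v = w, X = Y & a = c].
Proof. by move=> /(bij_inj (ox_iso_bij O)) [-> -> ->]. Qed.

Lemma ox_iso_split v X a :
  iso (v, X, a) = iso (v, 0, 0) + iso (0, X, 0) + iso (0, 0, a).
Proof.
rewrite -!linearD /=; congr (iso _).
by congr (_, _, _) => /=; rewrite ?(addr0, add0r).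
Qed.

Lemma ox_brE v w X Y a c :
  csl_br g (iso (v, X, a)) (iso (w, Y, c)) =
  iso (0, ox_nu O v w + (f v Y - f w X) + br X Y,
       ox_tau O v w + (gt v Y - gt w X) + beta X Y).
Proof.
have dualL (b : dual V) x : csl_br g (iso (0, 0, b)) x = 0.
  by rewrite (alternating_anti _ _ (@csl_br_alt _ g)) ox_br_dual oppr0.
rewrite (ox_iso_split v) (ox_iso_split w) !bilD !linearD /=.
rewrite !ox_br_dual !dualL !addr0 ox_br_VV ox_br_Vg ox_br_gg.
rewrite (alternating_anti (iso (0, X, 0)) _ (@csl_br_alt _ g)) ox_br_Vg.
rewrite -linearN -!linearD /=; congr (iso _).
by congr (_, _, _) => /=; rewrite ?(oppr0, addr0) // !addrA.
Qed.

(** J preserves the three summands, and on each pair of them the two components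
    of the bracket are single tensors, so these can be tested one by one; nu
    and tau pass because they are alternating on a complex line. *)
Lemma ox_abelianP :
  abelian_cs (csl_br g) (csl_J g) <->
  [/\ abelian_cs br J,
      forall v X, f (I v) (J X) = f v X,
      forall v X, gt (I v) (J X) = gt v X
    & forall X Y, beta (J X) (J Y) = beta X Y].
Proof.
split=> [ab|[ab f_inv g_inv beta_inv]].
  have Vg v X : f (I v) (J X) = f v X /\ gt (I v) (J X) = gt v X.
    have := ab (iso (v, 0, 0)) (iso (0, X, 0)).
    rewrite !ox_J !ox_brE !linear0 !lfunE /= !(subr0, add0r, addr0).
    by move=> /ox_iso_inj [_ -> ->].
  have gg X Y : br X Y = br (J X) (J Y) /\ beta (J X) (J Y) = beta X Y.
    have := ab (iso (0, X, 0)) (iso (0, Y, 0)).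
    rewrite !ox_J !ox_brE !linear0 !lfunE /= !(subr0, add0r, addr0).
    by move=> /ox_iso_inj [_ <- ->].
  split=> [X Y|v X|v X|X Y]; first [by case: (gg X Y) | by case: (Vg v X)].
have [iso' isoK isoK'] := ox_iso_bij O.
move=> x y; rewrite -(isoK' x) -(isoK' y).
case: (iso' x) => [[v X] a]; case: (iso' y) => [[w Y] c].
rewrite !ox_J !ox_brE !f_inv !g_inv beta_inv -ab.
rewrite (alternating_plane_inv (ox_dimV O) II _ _ (@ox_nu_alt _ _ _ O)).
by rewrite (alternating_plane_inv (ox_dimV O) II _ _ (@ox_tau_alt _ _ _ O)).
Qed.

(** This is the closedness of the symplectic form on (v, X, Y): beta pairs
    with v, and the two brackets of v with X and Y produce the terms in f. *)
Lemma ox_betaE X Y v :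
  beta X Y v = - (omega (f v X) Y + omega X (f v Y)).
Proof.
have := @csl_omega_closed _ g (iso (v, 0, 0)) (iso (0, X, 0)) (iso (0, Y, 0)).
rewrite !ox_brE !ox_omega !linear0 !lfunE /= !linear0.
rewrite !(subr0, sub0r, add0r, addr0) bilN.
rewrite -(alternating_anti _ _ (@csl_omega_alt _ gbar)).
rewrite lfunE /= add0r addrAC addrC => /eqP; rewrite addr_eq0.
by move=> /eqP.
Qed.

(** The V^*-component of the Nijenhuis tensor on (v, X), evaluated at w; the
    complex structure of V^* is precomposition with I. *)
Lemma ox_g_integrable v X w :
  gt v X w + gt (I v) X (I w) + gt v (J X) (I w) - gt (I v) (J X) w = 0.
Proof.
have := @csl_J_integrable _ g (iso (v, 0, 0)) (iso (0, X, 0)).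
rewrite /nijenhuis !ox_J !ox_brE !ox_J.
rewrite !linear0 !lfunE /= !(subr0, add0r, addr0).
rewrite -!linearD -linearB -(linear0 iso) /=.
move/ox_iso_inj=> [_ _ /lfunP/(_ w)].
by rewrite add_lfunE opp_lfunE !add_lfunE !comp_lfunE zero_lfunE.
Qed.

(** * The conditions on beta and g *)

Lemma ox_beta_invP v :
  (forall X Y, beta (J X) (J Y) v = beta X Y v) <->
  in_sp J omega (lin_part J (f v)).
Proof.
have wJ := @csl_omega_J _ gbar.
rewrite (in_sp_lin_part (f v) JJ wJ).
split=> inv X Y; first by apply: oppr_inj; rewrite -!ox_betaE inv.
by rewrite !ox_betaE -inv.
Qed.

(** With v_1 = v and v_2 = I v, integrability says that the defects
    D_1 = g_21 o J - g_11 and D_2 = g_22 o J - g_12 of the two required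
    equations satisfy D_2 = D_1 o J, and the condition on S says that
    D_2 = - D_1 o J; together they amount to D_1 = D_2 = 0. *)
Lemma ox_g_invP (v : V) : v != 0 ->
  (forall X, gt (I v) (J X) = gt v X) <->
  ox_S v (I v) = - ((2^-1 *: (ox_S v v - ox_S (I v) (I v))) \o J)%VF.
Proof.
move=> v0.
have SE u w X : ox_S u w X = 2^-1 * (gt u X w + gt w X u).
  by rewrite scale_lfunE add_lfunE !ox_gVVE.
have SeqE X : ox_S v (I v) X =
    (- ((2^-1 *: (ox_S v v - ox_S (I v) (I v))) \o J)%VF) X <->
    gt v X (I v) + gt (I v) X v = gt (I v) (J X) (I v) - gt v (J X) v.
  rewrite opp_lfunE comp_lfunE SE scale_lfunE dualB !SE.
  have halves (a b c d : R) :
    2^-1 * (a + b) = - (2^-1 * (2^-1 * (d + d) - 2^-1 * (c + c))) <->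
    a + b = c - d by split; lra.
  exact: halves.
have JJg u X : gt u (J (J X)) = - gt u X.
  by rewrite (almost_complexK X JJ) linearN.
have nij X :
    gt v (J X) v + gt (I v) (J X) (I v) = gt v X (I v) - gt (I v) X v.
  have := ox_g_integrable v (J X) v.
  rewrite !JJg !opp_lfunE.
  have rearrange (a b c d : R) : d + c - a - - b = 0 -> d + c = a - b by lra.
  exact: rearrange.
split=> [inv|S_eq].
  apply/lfunP=> X; apply/SeqE.
  by rewrite inv -(inv (J X)) JJg opp_lfunE opprK.
move=> X; apply/lfunP=> w.
have [k [l ->]] := complex_plane_span (ox_dimV O) II w v0.
have [E1 E2] :
    gt (I v) (J X) v = gt v X v /\ gt (I v) (J X) (I v) = gt v X (I v).
  (* the sum of S_eq and nij at X yields g_22 o J = g_12, their difference at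
     J X yields g_21 o J = g_11 *)
  have := nij (J X); have /SeqE := congr1 (fun a : dual gbar => a (J X)) S_eq.
  rewrite !JJg !opp_lfunE => S1 n1.
  have /SeqE S0 := congr1 (fun a : dual gbar => a X) S_eq.
  have n0 := nij X.
  have add (a b c d : R) : a + b = c - d -> d + c = a - b -> c = a by lra.
  have sub (a b c d : R) : a + b = - c - - d -> - d + - c = a - b -> b = d.
    by lra.
  by split; [exact: sub S1 n1 | exact: add S0 n0].
by rewrite !linearD !linearZ /= E1 E2.
Qed.

End Oxidation.

Theorem proposition6p3 (R : realType) (n : nat) (g gbar : csLie R)
    (O : oxidation g gbar)
    (dim_g : \dim {:g} = (4 * n)%N) (dim_gbar : \dim {:gbar} = (4 * n - 4)%N)
    (v1 : ox_V O) (v1_neq0 : v1 != 0) :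
  let Jb := csl_J gbar in
  let v2 := ox_I O v1 in
  let f1 := ox_f O v1 in
  let f2 := ox_f O v2 in
  let S11 := ox_S v1 v1 in
  let S12 := ox_S v1 v2 in
  let S22 := ox_S v2 v2 in
  abelian_cs (csl_br g) (csl_J g) <->
  [/\ abelian_cs (csl_br gbar) Jb,
      [/\ lin_part Jb f2 = - (Jb \o lin_part Jb f1)%VF,
          antilin_part Jb f2 = (Jb \o antilin_part Jb f1)%VF
        & in_sp Jb (csl_omega gbar) (lin_part Jb f1)]
    & S12 = - ((2^-1 *: (S11 - S22)) \o Jb)%VF].
Proof.
rewrite /=; set J := csl_J gbar; set I := ox_I O.
have JJ : almost_complex J := csl_J_sqr gbar.
have II : almost_complex I := ox_I_sqr O.
have wJ := @csl_omega_J _ gbar.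
have f_inv := plane_invP (ox_dimV O) II (ox_f O) JJ v1_neq0.
have g_inv := plane_invP (ox_dimV O) II (ox_g O) JJ v1_neq0.
have f_parts := comp_J_parts (ox_f O v1) (ox_f O (I v1)) JJ.
have S_eq := ox_g_invP v1_neq0.
split.
  move=> /(ox_abelianP O) [abJ /f_inv/f_parts[fl fa] /g_inv/S_eq S12 beta_inv].
  split=> //; split=> //; apply/ox_beta_invP => X Y.
  by rewrite beta_inv.
move=> [abJ [fl fa f_sp] S12]; apply/(ox_abelianP O).
split=> //; [exact/f_inv/f_parts | exact/g_inv/S_eq | move=> X Y].
apply/lfunP=> w.
have [k [l ->]] := complex_plane_span (ox_dimV O) II w v1_neq0.
have f2_sp : in_sp J (csl_omega gbar) (lin_part J (ox_f O (I v1))).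
  by rewrite fl; apply: in_sp_oppJ.
have /ox_beta_invP beta1 := f_sp.
have /ox_beta_invP beta2 := f2_sp.
by rewrite !linearD !linearZ /= beta1 beta2.
Qed.
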